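(* Let $K$ be a field and let $G$ be a finite simple graph without isolated vertices with $|E_G|>1$. Let $\prec$ be a grevlex order on $K[E_G]$. Let $\mathscr{E}$ be the set of Eulerian binomials of $K[E_G]$, let $\mathscr{T}=\{t_h^2-t_\ell^2 : h,\ell\in E_G\}$, and let $\mathscr{G}=\mathscr{T}\cup\mathscr{E}$. Then $\mathscr{G}$ is a Gröbner basis of the Eulerian ideal $I(X_G)$ with respect to $\prec$.
   Context: $G$ has vertex set $V_G$ and edge set $E_G$, a non-empty set of $2$-element subsets of $V_G$. Put $K[V_G]=K[x_i : i\in V_G]$ and $K[E_G]=K[t_h : h\in E_G]$. Let $\varphi\colon K[E_G]\to K[V_G]$ be the $K$-algebra homomorphism with $\varphi(t_h)=x_ix_j$ for $h=\{i,j\}\in E_G$. The Eulerian ideal of $G$ is $I(X_G)=\varphi^{-1}\big((x_i^2-x_j^2 : i,j\in V_G)\big)\subset K[E_G]$. For $\alpha\colon E_G\to\mathbb{N}$, write $\mathbf{t}^\alpha=\prod_{h\in E_G}t_h^{\alpha(h)}$ and $\mathcal{J}(\mathbf{t}^\alpha)=\{h\in E_G : \alpha(h)\text{ is odd}\}$. A set of edges defines the subgraph edge-induced by it. A subgraph of $G$ is called even Eulerian if all its vertices have even degree in the subgraph and its edge set has even cardinality (it need be neither connected nor spanning). A binomial $\mathbf{t}^\alpha-\mathbf{t}^\beta$ is called Eulerian if $\mathbf{t}^\alpha$ and $\mathbf{t}^\beta$ are distinct, relatively prime, square-free monomials of the same degree and the subgraph edge-induced by $\mathcal{J}(\mathbf{t}^\alpha)\cup\mathcal{J}(\mathbf{t}^\beta)$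 is an even Eulerian subgraph of $G$. A grevlex order on $K[E_G]$ is the graded reverse lexicographic order induced by $t_{\epsilon(1)}\succ t_{\epsilon(2)}\succ\cdots\succ t_{\epsilon(s)}$, where $s=|E_G|$ and $\epsilon\colon\{1,\dots,s\}\to E_G$ is a bijection. (The zero polynomial, obtained in $\mathscr{T}$ when $h=\ell$, plays no role in the Gröbner basis.) *)

(* Defs.v *)
From HB Require Import structures.
From mathcomp Require Import all_boot all_order all_algebra.
From mathcomp Require Import mpoly.

Set Implicit Arguments.
Unset Strict Implicit.
Unset Printing Implicit Defensive.

Import GRing.Theory.
Local Open Scope ring_scope.

Definition ideal_gen (R : comNzRingType) (S : R -> Prop) (p : R) : Prop :=
  exists cs : seq (R * R),
    (forall c, c \in cs -> S c.2) /\ p = \sum_(c <- cs) c.1 * c.2.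

Section Groebner.
Variables (K : fieldType) (n : nat) (prec : rel 'X_{1..n}).
Implicit Types (S G I : {mpoly K[n]} -> Prop) (f : {mpoly K[n]}).

(* [prec] is a strict monomial order. The zero polynomial has empty support,
   hence no leading monomial. *)
Definition lead_monomial f (m : 'X_{1..n}) : Prop :=
  m \in msupp f /\ {in msupp f, forall m', m' != m -> prec m' m}.

Definition initial_ideal S : {mpoly K[n]} -> Prop :=
  ideal_gen (fun q => exists f m, [/\ S f, lead_monomial f m & q = 'X_[m]]).

Definition groebner_basis G I : Prop :=
  [/\ exists s : seq {mpoly K[n]}, forall f, G f <-> f \in s,
      forall f, G f -> I f
    & forall p, initial_ideal G p <-> initial_ideal I p].

End Groebner.

(* Polynomials with variables indexed by a finite type [T] are taken in
   [{mpoly K[#|T|]}], the variable of [a : T] having index [enum_rank a]. *)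
Notation "'{mpoly_on' K [ T ] }" := {mpoly K[#|{: T}|]}
  (at level 0, K, T at level 2, format "'{mpoly_on'  K [ T ] }").

Definition var (K : fieldType) (T : finType) (a : T) : {mpoly_on K[T]} :=
  'X_(enum_rank a).

(* Graded reverse lexicographic order, strict, for the variables ranked
   eps 0 > eps 1 > ... > eps (s - 1): in equal degrees, m1 is smaller than m2
   when, at the last position (in this ranking) where they differ, m1 has the
   larger exponent. *)
Definition grevlex (T : finType) (s : nat) (eps : 'I_s -> T)
    (m1 m2 : 'X_{1..#|T|}) : bool :=
  let e (m : 'X_{1..#|T|}) (k : 'I_s) := m (enum_rank (eps k)) in
  (mdeg m1 < mdeg m2)%N ||
  (mdeg m1 == mdeg m2) &&
    [exists k : 'I_s, (e m2 k < e m1 k)%N &&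
       [forall j : 'I_s, (k < j)%N ==> (e m1 j == e m2 j)]].

Section Graph.
Variables (K : fieldType) (V : finType) (E : {set {set V}}).

Definition simple_graph : Prop := forall h, h \in E -> #|h| = 2%N.

Definition no_isolated_vertex : Prop :=
  forall v : V, exists2 h, h \in E & v \in h.

Definition edge : finType := {h : {set V} | h \in E}.

Definition phi (p : {mpoly_on K[edge]}) : {mpoly_on K[V]} :=
  p \mPo [tuple \prod_(v in val (enum_val i : edge)) var K v
         | i < #|{: edge}|].

Lemma phi_var (h : edge) (i j : V) :
  i != j -> val h = [set i; j] -> phi (var K h) = var K i * var K j.
Proof.
move=> neq_ij def_h; rewrite /phi /var comp_mpolyXU -tnth_nth tnth_mktuple.
by rewrite enum_rankK def_h big_setU1 ?inE //= big_set1.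
Qed.

Definition eulerian_ideal (p : {mpoly_on K[edge]}) : Prop :=
  ideal_gen (fun q => exists i j : V, q = var K i ^+ 2 - var K j ^+ 2) (phi p).

Definition tmon (alpha : edge -> nat) : {mpoly_on K[edge]} :=
  \prod_(h : edge) var K h ^+ alpha h.

Definition odd_edges (alpha : edge -> nat) : {set edge} :=
  [set h | odd (alpha h)].

Definition induced_vertices (F : {set edge}) : {set V} :=
  \bigcup_(h in F) val h.

Definition degree_in (F : {set edge}) (v : V) : nat :=
  #|[set h in F | v \in val h]|.

(* The subgraph edge-induced by [F] is even Eulerian. *)
Definition even_eulerian (F : {set edge}) : Prop :=
  {in induced_vertices F, forall v, ~~ odd (degree_in F v)} /\ ~~ odd #|F|.

Definition eulerian_binomial (f : {mpoly_on K[edge]}) : Prop :=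
  exists alpha beta : edge -> nat,
    f = tmon alpha - tmon beta /\
    [/\ tmon alpha != tmon beta,
        forall h, alpha h = 0 \/ beta h = 0,
        forall h, alpha h <= 1 /\ beta h <= 1,
        \sum_h alpha h = \sum_h beta h
      & even_eulerian (odd_edges alpha :|: odd_edges beta)]%N.

Definition square_difference (f : {mpoly_on K[edge]}) : Prop :=
  exists h l : edge, f = var K h ^+ 2 - var K l ^+ 2.

End Graph.

(* Main.v *)
From HB Require Import structures.
Require Import Defs.
From mathcomp Require Import all_boot all_order all_algebra.
From mathcomp Require Import mpoly zify.

(* The ideal (x_i^2 - x_j^2) is homogeneous for the grading of K[V_G] by the
   degree and the parities of the exponents. Hence, if t^m is the leading
   monomial of some f in I(X_G), then f contains a monomial t^m' < t^m of the
   same degree and the same parities of vertex degrees, and the edges where m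
   and m' have different parities form an even Eulerian subgraph F. Unless t^m
   is divisible by t_h^2 with h not the last edge, comparing degrees shows that
   the set A of edges of F which are odd in m is at least as large as its
   complement in F, and that the last edge of F lies outside A if they have the
   same size. Moving half of the excess out of A, including the last edge of F
   if it is in A, yields an Eulerian binomial whose leading monomial divides
   t^m. *)

Set Implicit Arguments.
Unset Strict Implicit.
Unset Printing Implicit Defensive.

Import GRing.Theory.
Local Open Scope ring_scope.

(** * Generated ideals and congruences modulo them *)

Section IdealGen.
Variable R : comNzRingType.
Implicit Types (S T : R -> Prop) (p q : R).

Lemma ideal_gen_mem S p : S p -> ideal_gen S p.
Proof.
move=> Sp; exists [:: (1, p)]; rewrite big_seq1 mul1r; split=> // c.
by rewrite inE => /eqP->.
Qed.

Lemma ideal_gen0 S : ideal_gen S 0.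
Proof. by exists [::]; rewrite ?big_nil. Qed.

Lemma ideal_genD S p q : ideal_gen S p -> ideal_gen S q -> ideal_gen S (p + q).
Proof.
move=> [cs [Scs ->]] [ds [Sds ->]]; exists (cs ++ ds); rewrite big_cat.
by split=> // c; rewrite mem_cat => /orP[/Scs|/Sds].
Qed.

Lemma ideal_genMl S p q : ideal_gen S q -> ideal_gen S (p * q).
Proof.
move=> [cs [Scs ->]]; exists [seq (p * c.1, c.2) | c <- cs].
split=> [c /mapP[d /Scs Sd ->] //|].
by rewrite big_map mulr_sumr; apply: eq_bigr => c _; rewrite mulrA.
Qed.

Lemma ideal_genB S p q : ideal_gen S p -> ideal_gen S q -> ideal_gen S (p - q).
Proof.
by move=> Sp Sq; rewrite -mulN1r; apply: ideal_genD (ideal_genMl _ _).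
Qed.

Lemma ideal_gen_sub S T p :
  (forall q, S q -> ideal_gen T q) -> ideal_gen S p -> ideal_gen T p.
Proof.
move=> sST [cs [Scs ->]]; elim: cs Scs => [|c cs IH] Scs.
  by rewrite big_nil; apply: ideal_gen0.
rewrite big_cons; apply: ideal_genD.
  by apply/ideal_genMl/sST/Scs; rewrite mem_head.
by apply: IH => d ds; apply: Scs; rewrite inE ds orbT.
Qed.

(** A difference lying in the ideal is read as a congruence; this rule lets congruences be
    multiplied, so that monomials can be treated one variable at a time. *)
Lemma ideal_gen_congrM S p p' q q' : ideal_gen S (p - p') ->
  ideal_gen S (q - q') -> ideal_gen S (p * q - p' * q').
Proof.
move=> Sp Sq.
have ->: p * q - p' * q' = p * (q - q') + q' * (p - p').
  by rewrite !mulrBr [q' * p]mulrC [q' * p']mulrC addrA subrK.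
by apply: ideal_genD; apply: ideal_genMl.
Qed.

Lemma ideal_gen_congr_prod S (I : Type) (r : seq I) (F G : I -> R) :
    (forall i, ideal_gen S (F i - G i)) ->
  ideal_gen S (\prod_(i <- r) F i - \prod_(i <- r) G i).
Proof.
move=> FG; elim/big_rec2: _ => [|i p q _ Spq].
  by rewrite subrr; apply: ideal_gen0.
exact: ideal_gen_congrM.
Qed.

Lemma ideal_gen_congrX S p q k :
  ideal_gen S (p - q) -> ideal_gen S (p ^+ k - q ^+ k).
Proof.
move=> Spq; elim: k => [|k IH]; first by rewrite subrr; apply: ideal_gen0.
by rewrite !exprS; apply: ideal_gen_congrM.
Qed.

End IdealGen.

(** * Sums of the coefficients at selected monomials *)

Section CoefSum.
Variables (R : nzRingType) (n : nat) (P : pred 'X_{1..n}).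

Definition coef_sum (p : {mpoly R[n]}) : R := \sum_(m <- msupp p | P m) p@_m.

(** Needed for linearity: polynomials with different supports are summed over one common list, the
    extra terms being zero. *)
Lemma coef_sum_widen (s : seq 'X_{1..n}) (p : {mpoly R[n]}) :
  uniq s -> {subset msupp p <= s} -> coef_sum p = \sum_(m <- s | P m) p@_m.
Proof.
move=> us sub.
rewrite [RHS](bigID (mem (msupp p))) /= [X in _ + X]big1 ?addr0; last first.
  by move=> m /andP[_ /memN_msupp_eq0].
rewrite /coef_sum -!(big_filter _ (fun m => _ && _)) -!(big_filter _ P).
apply: perm_big; apply: uniq_perm; rewrite ?filter_uniq ?msupp_uniq // => m.
rewrite !mem_filter; case: (boolP (m \in msupp p)) => [/sub->|];
  by rewrite ?andbT ?andbF.
Qed.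

Lemma coef_sum_is_linear : linear_for *%R coef_sum.
Proof.
move=> c p q; pose s := undup (msupp (c *: p + q) ++ msupp p ++ msupp q).
rewrite !(@coef_sum_widen s) ?undup_uniq //; try by move=> m m_in;
  rewrite mem_undup !mem_cat m_in ?orbT.
by rewrite mulr_sumr -big_split; apply: eq_bigr => m _; rewrite mcoeffD mcoeffZ.
Qed.

HB.instance Definition _ :=
  GRing.isLinear.Build R {mpoly R[n]} R *%R coef_sum coef_sum_is_linear.

Lemma coef_sumX m : coef_sum 'X_[m] = (P m)%:R.
Proof.
by rewrite /coef_sum msuppX big_mkcond big_seq1 mcoeffX eqxx; case: (P m).
Qed.

(** In each monomial multiple of the binomial, [P] selects both terms or neither, so their
    coefficients cancel. *)
Lemma coef_sum_mulXB p m1 m2 : (forall m, P (m + m1)%MM = P (m + m2)%MM) ->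
  coef_sum (p * ('X_[m1] - 'X_[m2])) = 0.
Proof.
move=> eqP12; rewrite [p]mpolyE mulr_suml linear_sum big1 // => m _.
rewrite -scalerAl linearZ /= mulrBr -!mpolyXD linearB /= !coef_sumX eqP12.
by rewrite subrr mulr0.
Qed.

End CoefSum.

(** * Monomials given by exponent functions on a finite type *)

Section Monomials.
Variable T : finType.
Implicit Types f : T -> nat.

Definition mnm_on f : 'X_{1..#|T|} := [multinom f (enum_val i) | i < #|T|].

Lemma mnm_onE f a : mnm_on f (enum_rank a) = f a.
Proof. by rewrite mnmE enum_rankK. Qed.

Definition exponents (m : 'X_{1..#|T|}) (a : T) : nat := m (enum_rank a).

Lemma mnm_onK : cancel exponents mnm_on.
Proof. by move=> m; apply/mnmP=> i; rewrite mnmE /exponents enum_valK. Qed.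

Lemma eq_mnm_on f1 f2 : f1 =1 f2 -> mnm_on f1 = mnm_on f2.
Proof. by move=> eqf; apply/mnmP=> i; rewrite !mnmE. Qed.

Lemma mdeg_mnm_on f : mdeg (mnm_on f) = (\sum_a f a)%N.
Proof.
rewrite mdegE (reindex _ (onW_bij _ (@enum_rank_bij T))) /=.
by apply: eq_bigr => a _; rewrite mnm_onE.
Qed.

Lemma mpolyX_mnm_on (K : fieldType) f :
  'X_[mnm_on f] = \prod_a var K a ^+ f a :> {mpoly_on K[T]}.
Proof.
rewrite mpolyXE_id (reindex _ (onW_bij _ (@enum_rank_bij T))) /=.
by apply: eq_bigr => a _; rewrite mnm_onE.
Qed.

Lemma mnm_on_delta (a : T) :
  mnm_on (fun b => (a == b : nat)) = U_(enum_rank a)%MM.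
Proof.
apply/mnmP=> i; rewrite mnmE mnm1E.
by rewrite -{2}(enum_valK i) (inj_eq enum_rank_inj).
Qed.

Lemma mnm_onD f1 f2 :
  mnm_on (fun a => f1 a + f2 a)%N = (mnm_on f1 + mnm_on f2)%MM.
Proof. by apply/mnmP=> i; rewrite mnmDE !mnmE. Qed.

(** The exponent 2 is written as a sum so that additivity, as in [mnm_onD] and [vertex_degD],
    applies to it. *)
Lemma varX2 (K : fieldType) (a : T) :
  var K a ^+ 2 = 'X_[mnm_on (fun b => (a == b) + (a == b))%N].
Proof. by rewrite mnm_onD mnm_on_delta mpolyXD expr2. Qed.

End Monomials.

(** * Parities of sums and balanced splitting of finite sets *)

Lemma odd_sum (I : finType) (P : pred I) (F : I -> nat) :
  odd (\sum_(i | P i) F i) = odd (\sum_(i | P i) odd (F i)).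
Proof. by elim/big_rec2: _ => // i m n _; rewrite !oddD oddb => ->. Qed.

Lemma exists_subset_card (T : finType) (A : {set T}) k d :
    k \in A -> (0 < d <= #|A|)%N ->
  exists2 A' : {set T}, A' \subset A & k \in A' /\ #|A'| = d.
Proof.
move=> kA /andP[d0 dA].
have: (d.-1 <= #|A :\ k|)%N.
  by move: dA; rewrite (cardsD1 k A) kA -{1}(prednK d0).
case/card_geqP=> s [us ss sA]; exists (k |: [set x in s]).
  rewrite subUset sub1set kA /=; apply/subsetP=> x; rewrite inE.
  by move/sA; rewrite !inE => /andP[].
have kNs : k \notin s by apply/negP=> /sA; rewrite !inE eqxx.
rewrite setU11 cardsU1 inE kNs.
by rewrite cardsE (card_uniqP us) ss add1n prednK.
Qed.

(** Meant for [a] the exponents of a leading monomial, [b] those of a smaller one and [r] the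
    position of a variable. Oddness of [a] on [A] will give divisibility, and the last element [k0]
    in [B] will make the monomial of [A] the leading one. *)
Lemma balanced_split (T : finType) (r : T -> nat) (a b : T -> nat) (k : T) :
    (forall h, (a h)./2 <= (b h)./2)%N -> (\sum_h a h = \sum_h b h)%N ->
    (a k < b k)%N -> (forall h, (r k < r h)%N -> a h = b h) ->
  exists A B : {set T}, [/\ [disjoint A & B], #|A| = #|B|,
    A :|: B = [set h | odd (a h + b h)], {in A, forall h, odd (a h)}
    & exists2 k0, k0 \in B & forall h, (r k0 < r h)%N -> h \notin A :|: B].
Proof.
move=> le_half eq_sum lt_k eq_gt_k.
pose A0 := [set h | odd (a h) && ~~ odd (b h)].
pose B0 := [set h | ~~ odd (a h) && odd (b h)].
pose e := (\sum_h ((b h)./2 - (a h)./2))%N.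
have cardAB : #|A0| = (#|B0| + e.*2)%N.
  have ->: #|A0| = (\sum_h (odd (a h) && ~~ odd (b h)))%N.
    rewrite -sum1_card big_mkcond.
    by apply: eq_bigr => h _; rewrite inE; case: ifP.
  have ->: #|B0| = (\sum_h (~~ odd (a h) && odd (b h)))%N.
    rewrite -sum1_card big_mkcond.
    by apply: eq_bigr => h _; rewrite inE; case: ifP.
  (* Adding the equal sums of [b] and [a] to the two sides leaves an identity for each [h];
     [le_half] makes the truncated subtraction exact. *)
  apply: (@addIn (\sum_h b h)); rewrite -{2}eq_sum -mul2n /e big_distrr /=.
  rewrite -!big_split; apply: eq_bigr => h _ /=; have := le_half h.
  have := odd_double_half (a h); have := odd_double_half (b h).
  by case: (odd (a h)) (odd (b h)) => [] []; rewrite -!mul2n /=; lia.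
have AB_disj : [disjoint A0 & B0].
  by rewrite disjoints_subset; apply/subsetP=> h; rewrite !inE; case: odd.
have AB_union : A0 :|: B0 = [set h | odd (a h + b h)].
  by apply/setP=> h; rewrite !inE oddD; case: odd; case: odd.
(* If [e] is zero, all halves agree, so [a] and [b] differ only by parity: [k] lies in [B0] and is
   last in the union. *)
have [e0|e_gt0] := posnP e.
  exists A0, B0; split=> //; first by rewrite cardAB e0 addn0.
    by move=> h; rewrite inE => /andP[].
  have eq_half h : (a h)./2 = (b h)./2.
    apply/eqP; rewrite eqn_leq le_half /= -subn_eq0.
    by move/eqP: e0; rewrite sum_nat_eq0 => /forallP/(_ h).
  exists k => [|h /eq_gt_k]; last by rewrite !inE => ->; case: odd.
  move: lt_k; rewrite inE -[a k]odd_double_half -[b k]odd_double_half eq_half.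
  by rewrite ltn_add2r !oddD !odd_double !addbF !oddb; case: odd; case: odd.
have [h0 Ah0] : exists h0, h0 \in A0.
  by apply/card_gt0P; rewrite cardAB; lia.
have F0 : h0 \in A0 :|: B0 by rewrite inE Ah0.
case: (@arg_maxnP _ h0 (mem (A0 :|: B0)) r F0) => k0 /= Fk0 k0_max.
(* [D] is the half of the excess that moves from [A0] to [B0]; it takes [k0] along if [k0] is in
   [A0]. *)
have [D sDA [k0BD cardD]] : exists2 D : {set T},
    D \subset A0 & k0 \in B0 :|: D /\ #|D| = e.
  have e_le : (0 < e <= #|A0|)%N by rewrite e_gt0 cardAB; lia.
  case/setUP: (Fk0) => [Ak0|Bk0].
    have [D sDA [k0D cardD]] := exists_subset_card Ak0 e_le.
    by exists D; rewrite // inE k0D orbT.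
  have [D sDA [_ cardD]] := exists_subset_card Ah0 e_le.
  by exists D; rewrite // inE Bk0.
have DB : [disjoint B0 & D].
  by rewrite disjoint_sym; apply: disjointWl AB_disj.
have eqU : (A0 :\: D) :|: (B0 :|: D) = A0 :|: B0.
  apply/setP=> h; have := subsetP sDA h; rewrite !inE.
  by case: (h \in D) => [/(_ isT)->|_] /=; rewrite ?orbT ?orbF.
exists (A0 :\: D), (B0 :|: D); rewrite eqU; split=> //.
- rewrite disjoints_subset; apply/subsetP=> h; rewrite !inE.
  by case/andP=> /negPf-> /andP[_ /negPf->]; rewrite andbF.
- rewrite cardsDS // cardsU disjoint_setI0 // cards0 cardAB cardD; lia.
- by move=> h; rewrite !inE => /andP[_ /andP[]].
by exists k0 => // h; rewrite ltnNge; apply: contra => /k0_max.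
Qed.

(** * The ideal generated by differences of squares of variables *)

Section SquareDifferences.
Variables (K : fieldType) (V : finType).

Definition square_diff_on (q : {mpoly_on K[V]}) : Prop :=
  exists i j : V, q = var K i ^+ 2 - var K j ^+ 2.

(** A normal form modulo the ideal: every square of a variable is traded for the square of the
    variable [v0], so only the parities and the number of squares survive. *)
Lemma square_diff_reduce (v0 : V) (a : V -> nat) :
  ideal_gen square_diff_on ('X_[mnm_on a] -
    'X_[mnm_on (fun v => odd (a v))] * (var K v0 ^+ 2) ^+ (\sum_v (a v)./2)).
Proof.
(* The power of the variable [v0] is distributed over the vertices, which allows a comparison factor
   by factor. *)
rewrite !mpolyX_mnm_on -prodrXr -big_split.
apply: ideal_gen_congr_prod => v /=.
rewrite -{1}[a v]odd_double_half exprD -mul2n exprM.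
apply: ideal_gen_congrM; first by rewrite subrr; apply: ideal_gen0.
by apply: ideal_gen_congrX; apply: ideal_gen_mem; exists v, v0.
Qed.

Lemma square_diff_congr (v0 : V) (a b : V -> nat) :
    (forall v, odd (a v) = odd (b v)) -> (\sum_v a v = \sum_v b v)%N ->
  ideal_gen square_diff_on ('X_[mnm_on a] - 'X_[mnm_on b]).
Proof.
move=> eq_odd eq_sum.
have half_sum (c : V -> nat) :
    (\sum_v c v = \sum_v odd (c v) + (\sum_v (c v)./2).*2)%N.
  rewrite -mul2n big_distrr -big_split; apply: eq_bigr => v _ /=.
  by rewrite mul2n odd_double_half.
have eq_half : (\sum_v (a v)./2 = \sum_v (b v)./2)%N.
  move: eq_sum; rewrite (half_sum a) (half_sum b).
  rewrite (eq_bigr (fun v => odd (b v) : nat)) => [|v _].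
    by move/addnI/double_inj.
  by rewrite eq_odd.
have := ideal_genB (square_diff_reduce v0 a) (square_diff_reduce v0 b).
rewrite eq_half.
have ->: mnm_on (fun v => odd (a v)) = mnm_on (fun v => odd (b v)).
  by apply: eq_mnm_on => v; rewrite eq_odd.
by rewrite opprB addrA subrK.
Qed.

Definition same_grade (m m' : 'X_{1..#|V|}) : bool :=
  (mdeg m' == mdeg m) && [forall i, odd (m' i) == odd (m i)].

(* Substituting 1 for the variables in one homogeneous component gives a linear
   form which vanishes on the ideal. *)
Lemma coef_sum_square_diff m q :
  ideal_gen square_diff_on q -> coef_sum (same_grade m) q = 0.
Proof.
move=> [cs [Scs ->]]; rewrite linear_sum big_seq big1 // => c /Scs [i [j ->]].
(* Multiplying by the square of any variable raises the degree by 2 and keeps all parities. *)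
rewrite /= /var !mpolyXn coef_sum_mulXB // => m'.
rewrite /same_grade !mdegD !mdeg1; congr (_ && _).
by apply: eq_forallb => k; rewrite !mnmDE !oddD !addbb.
Qed.

End SquareDifferences.

(** * Leading monomials and initial ideals *)

Section Leading.
Variables (K : fieldType) (n : nat) (prec : rel 'X_{1..n}).

Lemma lead_monomial_XB (m m' : 'X_{1..n}) : m' != m -> prec m' m ->
  lead_monomial prec ('X_[m] - 'X_[m'] : {mpoly K[n]}) m.
Proof.
move=> neq lt_m'm; split.
  by rewrite mcoeff_msupp mcoeffB !mcoeffX eqxx (negPf neq) subr0 oner_eq0.
move=> m1 m1S neq1; move: m1S; rewrite mcoeff_msupp mcoeffB !mcoeffX.
rewrite [m == m1]eq_sym (negPf neq1).
by case: (m' =P m1) => [<- //|_]; rewrite subrr eqxx.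
Qed.

Lemma initial_ideal_sub (G I : {mpoly K[n]} -> Prop) p :
  (forall f, G f -> I f) -> initial_ideal prec G p -> initial_ideal prec I p.
Proof.
move=> sGI; apply: ideal_gen_sub => _ [f [m [Gf fm ->]]].
by apply: ideal_gen_mem; exists f, m; split; first apply: sGI.
Qed.

Lemma initial_ideal_dvd (G : {mpoly K[n]} -> Prop) f (m m' : 'X_{1..n}) :
    G f -> lead_monomial prec f m' -> (forall i, m' i <= m i)%N ->
  initial_ideal prec G 'X_[m].
Proof.
move=> Gf lead_f /mnm_lepP le_m'm; rewrite -(submK le_m'm) mpolyXD.
by apply/ideal_genMl/ideal_gen_mem; exists f, m'.
Qed.

End Leading.

(** In equal degrees only the reverse lexicographic clause decides; the inverse [g] of the ranking
    lets it be stated with variables instead of positions. *)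
Lemma grevlexP (T : finType) s (eps : 'I_s -> T) (g : T -> 'I_s)
    (epsK : cancel eps g) (gK : cancel g eps) (m1 m2 : 'X_{1..#|T|}) :
  mdeg m1 = mdeg m2 ->
  reflect (exists2 k : T, (m2 (enum_rank k) < m1 (enum_rank k))%N
             & forall h, (g k < g h)%N -> m1 (enum_rank h) = m2 (enum_rank h))
          (grevlex eps m1 m2).
Proof.
move=> eq_deg; rewrite /grevlex eq_deg ltnn eqxx /=.
apply: (iffP existsP) => [[k /andP[lt_k /forallP eq_gt]]|[k lt_k eq_gt]].
  exists (eps k) => // h; rewrite epsK => lt_kh.
  by have /implyP/(_ lt_kh)/eqP := eq_gt (g h); rewrite gK.
exists (g k); rewrite gK lt_k; apply/forallP=> j; apply/implyP=> lt_kj.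
by rewrite eq_gt ?epsK.
Qed.

(** * Vertex degrees, the Eulerian ideal and Eulerian binomials *)

Section EulerianIdeal.
Variables (K : fieldType) (V : finType) (E : {set {set V}}).
Hypothesis simpleE : simple_graph E.
Implicit Types (a b : edge E -> nat) (A B : {set edge E}).

(** The degree of [v] in the multigraph with edge multiplicities [a], which is the exponent of the
    variable [v] in the image under [phi] of the monomial [a]. *)
Definition vertex_deg a (v : V) : nat :=
  (\sum_(h : edge E | v \in val h) a h)%N.

(** Handshake identity with multiplicities: each edge is counted at its two ends. *)
Lemma sum_vertex_deg a : (\sum_v vertex_deg a v = (\sum_h a h).*2)%N.
Proof.
rewrite /vertex_deg (exchange_big_dep xpredT) //= -mul2n big_distrr /=.
by apply: eq_bigr => h _; rewrite sum_nat_const (simpleE (valP h)).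
Qed.

Lemma phi_mnm_on a :
  phi 'X_[mnm_on a] = 'X_[mnm_on (vertex_deg a)] :> {mpoly_on K[V]}.
Proof.
rewrite /phi comp_mpolyX (reindex _ (onW_bij _ (@enum_rank_bij (edge E)))) /=.
rewrite mpolyX_mnm_on.
under eq_bigr => h _ do rewrite tnth_mktuple enum_rankK mnm_onE -prodrXl.
rewrite (exchange_big_dep xpredT) //=.
by apply: eq_bigr => v _; rewrite prodrXr.
Qed.

Lemma eulerian_ideal_XB (v0 : V) a b :
    (forall v, odd (vertex_deg a v) = odd (vertex_deg b v)) ->
    (\sum_h a h = \sum_h b h)%N ->
  eulerian_ideal ('X_[mnm_on a] - 'X_[mnm_on b] : {mpoly_on K[edge E]}).
Proof.
move=> eq_odd eq_sum; rewrite /eulerian_ideal /phi linearB /= -!/(phi _).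
rewrite !phi_mnm_on; apply: square_diff_congr => //.
by rewrite !sum_vertex_deg eq_sum.
Qed.

Lemma phiE (f : {mpoly_on K[edge E]}) :
  phi f = \sum_(m <- msupp f) f@_m *: 'X_[mnm_on (vertex_deg (exponents m))].
Proof.
rewrite /phi comp_mpolyEX; apply: eq_bigr => m _; rewrite -/(phi _).
by rewrite -{2}[m]mnm_onK phi_mnm_on.
Qed.

(** The coefficients of [f] at monomials whose images have the grade of the image of [m] sum to
    zero. The coefficient at [m] is nonzero, so another monomial must contribute. *)
Lemma eulerian_ideal_same_grade (f : {mpoly_on K[edge E]}) m :
    eulerian_ideal f -> m \in msupp f ->
  exists m', [/\ m' \in msupp f, m' != m,
    (\sum_h exponents m h = \sum_h exponents m' h)%N &
    forall v, odd (vertex_deg (exponents m) v) =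
              odd (vertex_deg (exponents m') v)].
Proof.
move=> If mf; pose d m := mnm_on (vertex_deg (exponents m)).
have: \sum_(m' <- msupp f | same_grade (d m) (d m')) f@_m' = 0.
  rewrite -[RHS](coef_sum_square_diff (d m) If) phiE linear_sum big_mkcond.
  apply: eq_bigr => m' _; rewrite linearZ /= coef_sumX.
  by case: ifP => _; rewrite ?mulr1 ?mulr0.
have mm : same_grade (d m) (d m) by rewrite /same_grade eqxx; apply/forallP=> i.
rewrite big_mkcond (bigD1_seq m) ?msupp_uniq //= mm.
have [/hasP[m' m'f /andP[/andP[/eqP eq_deg /forallP eq_odd] neq_m]] _|none] :=
  boolP (has (fun m' => same_grade (d m) (d m') && (m' != m)) (msupp f)).
  exists m'; split=> //.
    by apply/double_inj; rewrite -!sum_vertex_deg -!mdeg_mnm_on -/(d m) -eq_deg.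
  by move=> v; have /eqP := eq_odd (enum_rank v); rewrite !mnm_onE.
rewrite big1_seq ?addr0 => [/eqP|m' /andP[neq_m m'f]].
  by rewrite mcoeff_eq0 mf.
by case: ifP => // gr_m'; case/hasP: none; exists m'; rewrite // gr_m'.
Qed.

Definition indicator A h : nat := h \in A.

(** [A] and [B] are the supports of the two square-free monomials. Disjointness and equal size make
    the number of edges even, and vertices off the subgraph have degree zero, so parity is tested at
    every vertex. *)
Definition eulerian_pair A B : bool :=
  [&& A != B, [disjoint A & B], #|A| == #|B|
    & [forall v, ~~ odd (degree_in (A :|: B) v)]].

Lemma sum_indicator A : (\sum_h indicator A h = #|A|)%N.
Proof.
rewrite -sum1_card [RHS]big_mkcond; apply: eq_bigr => h _.
by rewrite /indicator; case: ifP.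
Qed.

Lemma degree_in_odd A v :
  odd (degree_in A v) = odd (vertex_deg (indicator A) v).
Proof.
congr odd; rewrite /degree_in -sum1_card /vertex_deg big_mkcond [RHS]big_mkcond.
apply: eq_bigr => h _; rewrite inE /indicator.
by case: (h \in A); case: (v \in _).
Qed.

Lemma vertex_degD a b v :
  vertex_deg (fun h => a h + b h)%N v = (vertex_deg a v + vertex_deg b v)%N.
Proof. by rewrite /vertex_deg big_split. Qed.

Lemma indicatorU A B : [disjoint A & B] ->
  indicator (A :|: B) =1 (fun h => indicator A h + indicator B h)%N.
Proof.
move=> AB h; rewrite /indicator inE.
by case: (boolP (h \in A)) => // /(disjointFr AB)->.
Qed.

Lemma degree_in_setU A B v : [disjoint A & B] ->
  odd (degree_in (A :|: B) v) =
  odd (vertex_deg (indicator A) v) (+) odd (vertex_deg (indicator B) v).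
Proof.
move=> AB; rewrite degree_in_odd -oddD -vertex_degD; congr odd.
by apply: eq_bigr => h _; rewrite indicatorU.
Qed.

(** A square-free monomial is determined by its set of odd edges. Passing to sets makes the
    binomials finite in number and their degrees cardinalities. *)
Lemma eulerian_binomialP (f : {mpoly_on K[edge E]}) :
  eulerian_binomial f <-> exists A B, eulerian_pair A B /\
    f = 'X_[mnm_on (indicator A)] - 'X_[mnm_on (indicator B)].
Proof.
split=> [[a [b [-> [neq cop sqf eq_sum [even_deg _]]]]]|]; last first.
  case=> A [B [/and4P[neq AB eqAB even_deg] ->]].
  have odd_ind (A' : {set edge E}) : odd_edges (indicator A') = A'.
    by apply/setP=> h; rewrite inE oddb.
  exists (indicator A), (indicator B); rewrite /tmon -!mpolyX_mnm_on.
  split=> //; rewrite !odd_ind; split.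
  - apply: contraNneq neq => /(congr1 (@msupp _ K)); rewrite !msuppX.
    move/eqP; rewrite eqseq_cons andbT => /eqP eq_mnm.
    apply/eqP/setP=> h; have: indicator A h = indicator B h.
      by rewrite -[LHS]mnm_onE eq_mnm mnm_onE.
    by rewrite /indicator; case: (h \in A); case: (h \in B).
  - move=> h; rewrite /indicator; case: (boolP (h \in A)); last by left.
    by move/(disjointFr AB)->; right.
  - by move=> h; rewrite /indicator !leq_b1.
  - by rewrite !sum_indicator (eqP eqAB).
  split; first by move=> v _; apply: (forallP even_deg).
  by rewrite cardsU disjoint_setI0 // cards0 subn0 (eqP eqAB) addnn odd_double.
exists (odd_edges a), (odd_edges b); rewrite /tmon -!mpolyX_mnm_on.
have indE c : (forall h, c h <= 1)%N -> indicator (odd_edges c) =1 c.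
  by move=> c1 h; rewrite /indicator inE; case: (c h) (c1 h) => [|[]].
have inda : indicator (odd_edges a) =1 a by apply: indE => h; case: (sqf h).
have indb : indicator (odd_edges b) =1 b by apply: indE => h; case: (sqf h).
rewrite (eq_mnm_on inda) (eq_mnm_on indb); split=> //; apply/and4P; split.
- apply: contraNneq neq => eq_ab; rewrite /tmon -!mpolyX_mnm_on.
  by rewrite -(eq_mnm_on inda) eq_ab (eq_mnm_on indb).
- rewrite disjoints_subset; apply/subsetP=> h; rewrite !inE.
  by case: (cop h) => ->.
- rewrite -!sum_indicator (eq_bigr _ (fun h _ => inda h)).
  by rewrite (eq_bigr _ (fun h _ => indb h)) eq_sum.
apply/forallP=> v; set F := _ :|: _.
have [/even_deg//|vNF] := boolP (v \in induced_vertices F).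
rewrite /degree_in (_ : [set _ in _ | _] = set0) ?cards0 //.
apply/setP=> h; rewrite in_set0 in_set; apply: contraNF vNF => /andP[hF vh].
by apply/bigcupP; exists h.
Qed.

Lemma square_difference_ideal (f : {mpoly_on K[edge E]}) :
  square_difference f -> eulerian_ideal f.
Proof.
move=> [h [l ->]].
(* An end of [h] serves as the base vertex of the reduction of squares. *)
have /set0Pn[v0 _] : val h != set0 by rewrite -cards_eq0 (simpleE (valP h)).
rewrite !varX2; apply: eulerian_ideal_XB => // [v|].
  by rewrite !vertex_degD !addnn !odd_double.
have sum_delta (k : edge E) : (\sum_j (k == j) = 1)%N.
  by rewrite (bigD1 k) //= eqxx big1 // => j; rewrite eq_sym => /negPf->.
by rewrite !big_split /= !sum_delta.
Qed.

(** Even degree in the disjoint union means that the degrees in [A] and in [B] have the same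
    parity. *)
Lemma eulerian_binomial_ideal (f : {mpoly_on K[edge E]}) :
  eulerian_binomial f -> eulerian_ideal f.
Proof.
case/eulerian_binomialP=> A [B [/and4P[neq AB /eqP eqAB /forallP even_deg] ->]].
have [h hA] : exists h, h \in A.
  apply/set0Pn; apply: contra_neq neq => A0.
  by apply/esym/eqP; rewrite A0 -cards_eq0 -eqAB A0 cards0.
have /set0Pn[v0 _] : val h != set0 by rewrite -cards_eq0 (simpleE (valP h)).
apply: eulerian_ideal_XB => // [v|]; last by rewrite !sum_indicator.
by have := even_deg v; rewrite degree_in_setU // negb_add => /eqP.
Qed.

Lemma finite_groebner_set : exists s : seq {mpoly_on K[edge E]},
  forall f, square_difference f \/ eulerian_binomial f <-> f \in s.
Proof.
pose s1 := [seq var K h ^+ 2 - var K l ^+ 2 : {mpoly_on K[edge E]}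
           | h <- enum (edge E), l <- enum (edge E)].
pose binomial (AB : {set edge E} * {set edge E}) : {mpoly_on K[edge E]} :=
  'X_[mnm_on (indicator AB.1)] - 'X_[mnm_on (indicator AB.2)].
pose s2 := [seq binomial AB | AB <- enum predT & eulerian_pair AB.1 AB.2].
exists (s1 ++ s2) => f; rewrite mem_cat; split=> [[|]|/orP[]].
- move=> [h [l ->]]; apply/orP; left.
  by apply/allpairsP; exists (h, l); rewrite !mem_enum.
- case/eulerian_binomialP=> A [B [AB ->]]; apply/orP; right.
  by apply/mapP; exists (A, B); rewrite // mem_filter AB mem_enum.
- by case/allpairsP=> -[h l] [_ _ ->]; left; exists h, l.
case/mapP=> -[A B]; rewrite mem_filter => /andP[AB _] ->; right.
by apply/eulerian_binomialP; exists A, B.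
Qed.


(** * Leading monomials for the grevlex order *)

Section Grevlex.
Variables (s : nat) (eps : 'I_s -> edge E) (g : edge E -> 'I_s).
Hypotheses (epsK : cancel eps g) (gK : cancel g eps).

Lemma lead_square_difference (h l : edge E) :
    (forall j, g j <= g l)%N -> h != l ->
  lead_monomial (grevlex eps) (var K h ^+ 2 - var K l ^+ 2)
    (mnm_on (fun j => (h == j) + (h == j))%N).
Proof.
move=> le_l neq_hl; rewrite !varX2.
have lt_l : ((h == l) + (h == l) < (l == l) + (l == l))%N.
  by rewrite eqxx (negPf neq_hl).
apply: lead_monomial_XB.
  apply: contraTneq lt_l => /(congr1 (fun m => exponents m l)).
  by rewrite /exponents !mnm_onE => ->; rewrite ltnn.
apply/(grevlexP epsK gK); first by rewrite !mnm_onD !mnm_on_delta !mdegD !mdeg1.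
by exists l => [|j]; rewrite ?mnm_onE // ltnNge le_l.
Qed.

(** The comparison is decided at [k], the last edge of the union; the monomial of [B] has the larger
    exponent there and is therefore the smaller one. *)
Lemma lead_eulerian_binomial A B (k : edge E) :
    [disjoint A & B] -> #|A| = #|B| -> k \in B ->
    (forall h, (g k < g h)%N -> h \notin A :|: B) ->
  lead_monomial (grevlex eps)
    ('X_[mnm_on (indicator A)] - 'X_[mnm_on (indicator B)]
       : {mpoly_on K[edge E]})
    (mnm_on (indicator A)).
Proof.
move=> AB eqAB kB k_max.
have lt_k : (indicator A k < indicator B k)%N.
  by rewrite /indicator kB (disjointFl AB kB).
apply: lead_monomial_XB.
  apply: contraTneq lt_k => /(congr1 (fun m => exponents m k)).
  by rewrite /exponents !mnm_onE => ->; rewrite ltnn.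
apply/(grevlexP epsK gK); first by rewrite !mdeg_mnm_on !sum_indicator eqAB.
exists k; rewrite ?mnm_onE // => h /k_max; rewrite !mnm_onE /indicator inE.
by rewrite negb_or => /andP[/negPf-> /negPf->].
Qed.

Lemma eulerian_ideal_lead (f : {mpoly_on K[edge E]}) m (l : edge E) :
    (forall j, g j <= g l)%N -> eulerian_ideal f ->
    lead_monomial (grevlex eps) f m ->
  initial_ideal (grevlex eps)
    (fun f => square_difference f \/ eulerian_binomial f)
    ('X_[m] : {mpoly_on K[edge E]}).
Proof.
move=> le_l If [mf m_lead].
have [m' [m'f neq_m' eq_sum eq_odd]] := eulerian_ideal_same_grade If mf.
have eq_deg : mdeg m' = mdeg m by rewrite -[m]mnm_onK -[m']mnm_onK !mdeg_mnm_on.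
have /(grevlexP epsK gK eq_deg)[k lt_k eq_gt] := m_lead _ m'f neq_m'.
case: (boolP [exists h, (h != l) && (1 < exponents m h)%N]) => [|small_m].
  case/existsP=> h /andP[neq_hl gt1].
  have lead_h := lead_square_difference le_l neq_hl.
  apply: initial_ideal_dvd lead_h _; first by left; exists h, l.
  move=> i; rewrite -[i]enum_valK mnm_onE.
  by case: eqP => // <-; rewrite addn1.
(* Away from [l] the exponents of [m] are at most 1. At [l], the deciding edge [k] either is [l],
   where [m'] has the larger exponent, or precedes it, and then the exponents agree. *)
have half_le h : ((exponents m h)./2 <= (exponents m' h)./2)%N.
  have [->|neq_hl] := eqVneq h l.
    apply: half_leq; have := le_l k; rewrite leq_eqVlt.
    case/predU1P=> [/val_inj/(can_inj gK)<-|/eq_gt eq_l]; first exact: ltnW.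
    by rewrite /exponents eq_l.
  move: small_m; rewrite negb_exists => /forallP/(_ h); rewrite neq_hl -leqNgt.
  by case: (exponents m h) => [|[]].
have [A [B [AB cardAB eqAB oddA [k0 k0B k0_max]]]] :=
  balanced_split half_le eq_sum lt_k (fun h lt => esym (eq_gt h lt)).
have k0A := disjointFl AB k0B.
have lead_A := lead_eulerian_binomial AB cardAB k0B k0_max.
apply: initial_ideal_dvd lead_A _.
  right; apply/eulerian_binomialP; exists A, B; split=> //; apply/and4P.
  split; rewrite ?cardAB //.
    by apply: contraTneq k0B => <-; rewrite k0A.
  (* The degree of [v] has the parity of the sum of its degrees in [m] and [m'], which are congruent
     modulo 2. *)
  apply/forallP=> v; rewrite degree_in_odd eqAB odd_sum.
  under eq_bigr => h _ do rewrite /indicator inE oddb.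
  by rewrite -odd_sum -/(vertex_deg _ v) vertex_degD oddD eq_odd addbb.
move=> i; rewrite -[i]enum_valK mnm_onE /indicator.
by case: (boolP (_ \in A)) => // /oddA/odd_gt0.
Qed.

End Grevlex.

End EulerianIdeal.

(* The Groebner basis of the Eulerian ideal *)
Local Close Scope ring_scope.

Theorem theorem3p3 (K : fieldType) (V : finType) (E : {set {set V}})
    (simpleE : simple_graph E) (noisoE : no_isolated_vertex E)
    (cardE : 1 < #|E|)
    (eps : 'I_#|E| -> edge E) (bij_eps : bijective eps) :
  groebner_basis (K := K) (grevlex eps)
    (fun f => square_difference f \/ eulerian_binomial f)
    (@eulerian_ideal K V E).
Proof.
have sGI (f : {mpoly_on K[edge E]}) :
    square_difference f \/ eulerian_binomial f -> eulerian_ideal f.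
  by case; [apply: square_difference_ideal | apply: eulerian_binomial_ideal].
split=> // [|p]; first exact: finite_groebner_set.
split; first exact: initial_ideal_sub.
case: bij_eps => g epsK gK; apply: ideal_gen_sub => _ [f [m [If lead_f ->]]].
(* Positions start at 0, so the smallest variable is the one at position [#|E|.-1]. *)
have last_lt : #|E|.-1 < #|E| by rewrite prednK // ltnW.
pose l := eps (Ordinal last_lt).
apply: (eulerian_ideal_lead simpleE epsK gK (l := l)) If lead_f.
by move=> h; rewrite /l epsK /= -ltnS prednK ?ltn_ord // ltnW.
Qed.
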